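(* Let $\lambda$ be a Ferrers shape and let $\mathbf a=(a_1,a_2,\dots)$ be a finite sequence of positive integers. Then $$\bigl|W^{(a_1,a_2,\dots)}_\lambda(\{231,121\})\bigr|=\bigl|W^{(a_1,a_2,\dots)}_\lambda(\{312,211\})\bigr|.$$ That is, the sets of patterns $\{231,121\}$ and $\{312,211\}$ are shape-Wilf-equivalent for words.
   Context: A Ferrers shape $\lambda=(\lambda_1,\lambda_2,\dots)$ with $\lambda_1\ge\lambda_2\ge\cdots$ is drawn in French convention: a left-justified arrangement of cells with $\lambda_i$ cells in row $i$, rows numbered from bottom (row 1) to top; columns are numbered from left to right. A $0$-$1$-filling of $\lambda$ assigns $0$ or $1$ to each cell. For a word $x=x_1x_2\cdots x_r$ over the positive integers with largest letter $M$, let $M(x)$ be the $M\times r$ $0$-$1$ matrix (rows numbered bottom to top) having a $1$ in row $x_j$ of column $j$ for each $j$, and $0$ elsewhere. A filling $F$ of $\lambda$ contains $x$ if there are rows $\rho_1<\rho_2<\dots<\rho_M$ and columns $c_1<c_2<\dots<c_r$ such that every cell (row $\rho_l$, column $c_j$) lies in $\lambda$ and the entries of $F$ in these cells form exactly the matrix $M(x)$; otherwise $F$ avoids $x$. For a set $\Omega$ of words, $W^{(a_1,a_2,\dots)}_\lambda(\Omega)$ denotes the set of $0$-$1$-fillings of $\lambda$ with exactly one $1$ in each column, exactly $a_i$ ones in row $i$ for each $i$, and which avoid every word in $\Omega$. Two sets of words $\Omega,\Sigma$ are shape-Wilf-equivalent for words if $|W^{(a_1,a_2,\dots)}_\lambda(\Omega)|=|W^{(a_1,a_2,\dots)}_\lambda(\Sigma)|$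 for all finite sequences of positive integers $a_1,a_2,\dots$ and all Ferrers shapes $\lambda$. *)

(* Defs.v *)
From mathcomp Require Import all_boot.
Set Implicit Arguments. Unset Strict Implicit. Unset Printing Implicit Defensive.

(* Conventions (0-indexed internally):
   A Ferrers shape is a seq nat [l_1; l_2; ...] (row 1 = bottom = index 0),
   nonincreasing with positive parts.  Cell (row r, column c) belongs to the
   shape iff r < size lam and c < nth 0 lam r.  Row index r corresponds to the
   paper's row r+1, column index c to the paper's column c+1. *)

Definition ferrers (lam : seq nat) : bool :=
  sorted geq lam && all (fun x => 0 < x) lam.

Definition in_shape (lam : seq nat) (r c : nat) : bool :=
  (r < size lam) && (c < nth 0 lam r).

(* A 0-1 filling of lam: a boolean function on the bounding rectangle
   (size lam rows, head 0 lam = lambda_1 columns) which vanishes outside lam. *)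
Notation rect lam := {ffun 'I_(size lam) * 'I_(head 0 lam) -> bool}.

Definition entry (lam : seq nat) (F : rect lam) (r c : nat) : bool :=
  match (insub r : option 'I_(size lam)), (insub c : option 'I_(head 0 lam)) with
  | Some i, Some j => F (i, j)
  | _, _ => false
  end.

Definition is_filling (lam : seq nat) (F : rect lam) : bool :=
  [forall ij : 'I_(size lam) * 'I_(head 0 lam), F ij ==> in_shape lam ij.1 ij.2].

Definition one_per_column (lam : seq nat) (F : rect lam) : bool :=
  [forall c : 'I_(head 0 lam), #|[set r : 'I_(size lam) | F (r, c)]| == 1].

(* number of 1s in row r (0 if r is not a row of lam) *)
Definition row_count (lam : seq nat) (F : rect lam) (r : nat) : nat :=
  #|[set c : 'I_(head 0 lam) | entry F r c]|.

Definition row_sums (lam : seq nat) (a : seq nat) (F : rect lam) : bool :=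
  [forall i : 'I_(maxn (size lam) (size a)), row_count F i == nth 0 a i].

Definition maxletter (x : seq nat) : nat := foldr maxn 0 x.

Definition contains (lam : seq nat) (F : rect lam) (x : seq nat) : bool :=
  [exists rho : {ffun 'I_(maxletter x) -> 'I_(size lam)},
   exists col : {ffun 'I_(size x) -> 'I_(head 0 lam)},
     [forall l1 : 'I_(maxletter x), forall l2 : 'I_(maxletter x),
        (l1 < l2) ==> (rho l1 < rho l2)] &&
     [forall j1 : 'I_(size x), forall j2 : 'I_(size x),
        (j1 < j2) ==> (col j1 < col j2)] &&
     [forall l : 'I_(maxletter x), forall j : 'I_(size x),
        in_shape lam (rho l) (col j) &&
        (F (rho l, col j) == (nth 0 x j == (nat_of_ord l).+1))]].

Definition avoids (lam : seq nat) (F : rect lam) (x : seq nat) : bool :=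
  ~~ contains F x.

Definition W (lam : seq nat) (a : seq nat) (Omega : seq (seq nat)) : {set rect lam} :=
  [set F : rect lam | [&& is_filling F, one_per_column F, row_sums a F
                        & all (avoids F) Omega]].

(* Main.v *)
(** Read the columns from right to left and build the resulting word row by row,
    inserting the copies of the new largest letter one at a time and deleting the
    first letter whenever the boundary of the shape makes a horizontal step.  For
    {231, 121} the new letter must be put at a cut of the word (everything before
    the cut larger than everything after it), for {312, 211} at the end of a
    strictly increasing prefix.  Hence all that matters is the composition of the
    length of the word into indecomposable blocks in the first case, into maximal
    increasing runs in the second: an insertion merges the first few blocks and
    adds a cell, respectively splits the first run and adds a cell, while a
    deletion shortens the first part in both cases.

    The two processes have the same number of closed runs because both refine the
    same lazy process on words in two letters L and I, in which the insertions
    that create a new block (extend the first run) push L, the other ones push I,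
    and a deletion removes either the last L, or a final I.  Each lazy state is
    mapped to a multiset of compositions, and the multisets for both processes
    obey the same recurrences. *)

Require Import Defs.
From mathcomp Require Import all_boot.
From mathcomp Require Import zify.
Set Implicit Arguments. Unset Strict Implicit. Unset Printing Implicit Defensive.

(** * The abstract process *)

(* A composition is encoded by the increasing list of the 0-based positions of
   the last cells of its parts; deleting the first cell shifts these down, and
   drops the first part if it had size one. *)
Definition pred_ends (s : seq nat) : seq nat :=
  if s is 0 :: r then map predn r else map predn s.

Definition remove (phi : seq nat -> nat) (s : seq nat) : nat :=
  if s is [::] then 0 else phi (pred_ends s).

Lemma map_succnK (s : seq nat) : map predn (map succn s) = s.
Proof. by rewrite -map_comp map_id_in. Qed.

Lemma pred_ends_map_succn (s : seq nat) : pred_ends (map succn s) = s.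
Proof. by case: s => //= q s; rewrite map_succnK. Qed.

Lemma remove_map_succn (phi : seq nat -> nat) (s : seq nat) :
  s != [::] -> remove phi (map succn s) = phi s.
Proof. by case: s => // q s _; rewrite /remove -[RHS](congr1 phi (pred_ends_map_succn _)). Qed.

(* [Same] inserts a further copy of the current largest letter. *)
Inductive op := Add | Same | Remove.

(* [None] stands for the empty word; a nonempty word of length [h] has a lazy state
   of length [h - 1], with [true] for L, [false] for I, and the top at the head. *)
Fixpoint lazy_runs (D : seq op) (o : option (seq bool)) : nat :=
  match D, o with
  | [::], Some _ => 0
  | [::], None => 1
  | Add :: D', None => lazy_runs D' (Some [::])
  | Add :: D', Some v =>
      lazy_runs D' (Some (true :: v)) + lazy_runs D' (Some (false :: v))
  | Same :: D', None => 0
  | Same :: D', Some v => lazy_runs D' (Some (false :: v))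
  | Remove :: D', None => 0
  | Remove :: D', Some [::] => lazy_runs D' None
  | Remove :: D', Some (true :: v) => lazy_runs D' (Some v)
  | Remove :: D', Some (false :: v) =>
      lazy_runs D' (Some v)
      + (if true \in v then lazy_runs D' (Some (false :: rem true v)) else 0)
  end.

(** Operations act on test functions by summing over all outcomes. [Same] has no [push] outcome
    because equal letters are inserted in a fixed order. *)
Definition step (push : seq nat -> seq nat)
    (branch : (seq nat -> nat) -> seq nat -> nat) (o : op) (phi : seq nat -> nat) :
    seq nat -> nat :=
  match o with
  | Add => fun s => phi (push s) + branch phi s
  | Same => branch phi
  | Remove => remove phi
  end.

(* The number of ways to carry out the operations [D] from a given state and end
   with the empty word. *)
Definition runs push branch (D : seq op) : seq nat -> nat :=
  foldr (step push branch) (fun s => s == [::] : nat) D.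

(** * Conditions under which a machine has as many closed runs as the lazy process *)

Section Machine.

Variable push : seq nat -> seq nat.
Variables branch branch' : (seq nat -> nat) -> seq nat -> nat.

Hypothesis push_nil : push [::] = [:: 0].
Hypothesis push_neq0 : forall s, push s != [::].
Hypothesis pred_ends_push : forall s, pred_ends (push s) = s.
Hypothesis branch_nil : forall phi, branch phi [::] = 0.
Hypothesis eq_branch : forall phi psi,
  (forall s, s != [::] -> phi s = psi s) -> branch phi =1 branch psi.
Hypothesis branchD : forall phi psi s,
  branch (fun r => phi r + psi r) s = branch phi s + branch psi s.
(* [branch'] collects the outcomes of an insertion followed by a deletion that do
   not restore the original state. *)
Hypothesis branch_remove : forall phi s, s != [::] ->
  branch (remove phi) s = phi s + branch' phi s.
Hypothesis branch'_single : forall phi, branch' phi [:: 0] = 0.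
Hypothesis branch'_push : forall phi s, s != [::] ->
  branch' phi (push s) = branch phi s.
Hypothesis branch_branch' : forall phi s, s != [::] ->
  branch (branch' phi) s = branch' (branch phi) s.

(* The sum of [phi] over the multiset of compositions refining the lazy state [v]. *)
Fixpoint expect (v : seq bool) (phi : seq nat -> nat) : nat :=
  match v with
  | [::] => phi [:: 0]
  | true :: v' => expect v' (phi \o push)
  | false :: v' => expect v' (branch phi)
  end.

Lemma eq_expect (v : seq bool) (phi psi : seq nat -> nat) :
  (forall s, s != [::] -> phi s = psi s) -> expect v phi = expect v psi.
Proof.
elim: v phi psi => [|[] v IHv] phi psi eq_phi /=; first exact: eq_phi.
  by apply: IHv => s _ /=; apply: eq_phi.
by apply: IHv => s _ /=; apply: eq_branch.
Qed.

Lemma expectD (v : seq bool) (phi psi : seq nat -> nat) :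
  expect v (fun s => phi s + psi s) = expect v phi + expect v psi.
Proof.
elim: v phi psi => [|[] v IHv] phi psi //=; rewrite -IHv //.
by apply: eq_expect => s _; apply: branchD.
Qed.

(** [branch'] commutes past every I down to the last L, where [branch'] after [push] is [branch]:
    that L disappears and an I appears on top. Without an L, the one-cell composition is reached and
    contributes nothing. *)
Lemma expect_branch' (v : seq bool) (phi : seq nat -> nat) :
  expect v (branch' phi) =
  if true \in v then expect (rem true v) (branch phi) else 0.
Proof.
elim: v phi => [|[] v IHv] phi /=; first exact: branch'_single.
  by apply: eq_expect => s s_neq0 /=; apply: branch'_push.
rewrite in_cons /= -IHv.
by apply: eq_expect => s s_neq0; apply: branch_branch'.
Qed.

(** These are the [Remove] clauses of [lazy_runs]: a deletion undoes a final L; after a final I it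
    either restores the state or acts as [branch']. *)
Lemma expect_remove (v : seq bool) (phi : seq nat -> nat) :
  expect v (remove phi) =
  match v with
  | [::] => phi [::]
  | true :: v' => expect v' phi
  | false :: v' =>
      expect v' phi
      + (if true \in v' then expect (false :: rem true v') phi else 0)
  end.
Proof.
case: v => [|[] v] //=.
  apply: eq_expect => s _ /=; rewrite -[in RHS](pred_ends_push s).
  by case: (push s) (push_neq0 s).
by rewrite -expect_branch' -expectD; apply: eq_expect => s /branch_remove.
Qed.

Lemma expect_end (v : seq bool) : expect v (fun s => s == [::] : nat) = 0.
Proof.
have expect0 u : expect u (fun _ => 0) = 0.
  (* Additivity makes this number equal to its own double. *)
  have E : expect u (fun=> 0) = expect u (fun=> 0) + expect u (fun=> 0).
    exact: (expectD u (fun=> 0) (fun=> 0)).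
  lia.
rewrite -(expect0 v); by apply: eq_expect => s /negPf ->.
Qed.

Lemma runs_lazyE (D : seq op) :
  runs push branch D [::] = lazy_runs D None
  /\ forall v, expect v (runs push branch D) = lazy_runs D (Some v).
Proof.
elim: D => [|o D [IHn IHs]]; first by split=> // v; apply: expect_end.
case: o => /=; split=> [|v] //.
- by rewrite push_nil branch_nil addn0 -(IHs [::]).
- by rewrite expectD -!IHs.
- by rewrite -IHs.
- by rewrite expect_remove IHn; case: v => [|[] v] //; rewrite !IHs.
Qed.

End Machine.

(** * The two machines, on blocks and on increasing runs *)

Definition pushA (s : seq nat) : seq nat := 0 :: map succn s.

Fixpoint suffix_sum (phi : seq nat -> nat) (s : seq nat) : nat :=
  if s is _ :: r then phi s + suffix_sum phi r else 0.

(** Passing to a nonempty suffix of the ends merges all blocks up to its first end; the shift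
    accounts for the added cell. *)
Definition branchA (phi : seq nat -> nat) : seq nat -> nat :=
  suffix_sum (phi \o map succn).

Lemma eq_suffix_sum (phi psi : seq nat -> nat) :
  (forall s, s != [::] -> phi s = psi s) -> suffix_sum phi =1 suffix_sum psi.
Proof. by move=> eq_phi; elim=> //= q s ->; rewrite eq_phi. Qed.

Lemma suffix_sumD (phi psi : seq nat -> nat) (s : seq nat) :
  suffix_sum (fun r => phi r + psi r) s = suffix_sum phi s + suffix_sum psi s.
Proof. by elim: s => //= q s ->; rewrite addnACA. Qed.

Lemma suffix_sum_map (phi : seq nat -> nat) (f : nat -> nat) (s : seq nat) :
  suffix_sum phi (map f s) = suffix_sum (phi \o map f) s.
Proof. by elim: s => //= q s ->. Qed.

(** Both sides sum over nested suffixes, matched by replacing the outer one with its tail; an empty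
    tail contributes nothing. *)
Lemma suffix_sum_behead (phi : seq nat -> nat) (s : seq nat) :
  suffix_sum (suffix_sum phi \o behead) s = suffix_sum (suffix_sum phi) (behead s).
Proof. by elim: s => //= q [|q' s] //= ->. Qed.

Definition pushB (s : seq nat) : seq nat :=
  if s is [::] then [:: 0] else map succn s.

(** The new cell goes to position [p] and becomes an end. Since [p <= q], an old cell of the first
    run follows it, so the run is really split. *)
Definition branchB (phi : seq nat -> nat) (s : seq nat) : nat :=
  if s is q :: _ then \sum_(p < q.+1) phi ((p : nat) :: map succn s) else 0.

(** Both counts equal [lazy_runs D None]. With the length unchanged, [branch'] merges at least two
    leading blocks in the first machine and cuts the first run into two nonempty parts in the
    second. *)
Lemma runs_AB (D : seq op) :
  runs pushA branchA D [::] = runs pushB branchB D [::].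
Proof.
rewrite (proj1 (@runs_lazyE pushA branchA
  (fun phi => suffix_sum phi \o behead) _ _ _ _ _ _ _ _ _ _ D)) //; last first.
- move=> phi s _; rewrite /branchA /= -suffix_sum_behead.
  by apply: eq_suffix_sum => r _ /=; rewrite behead_map suffix_sum_map.
- by move=> phi s _; rewrite /pushA /= suffix_sum_map.
- move=> phi [|q s] // _; rewrite -[RHS]/(suffix_sum phi (q :: s)).
  by apply: eq_suffix_sum => r; apply: remove_map_succn.
- by move=> phi psi s; apply: suffix_sumD.
- move=> phi psi eq_phi; apply: eq_suffix_sum => s s_neq0 /=.
  by apply: eq_phi; case: s s_neq0.
- exact: map_succnK.
rewrite (proj1 (@runs_lazyE pushB branchB
  (fun phi s => \sum_(p < head 0 s) phi ((p : nat) :: s))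
  _ _ _ _ _ _ _ _ _ _ D)) //; last first.
(* The two double sums differ by a shift of the outer cut by one; the cut at 0 leaves an empty inner
   sum. *)
- move=> phi [|q s] // _; rewrite /branchB /= big_ord_recl big_ord0 add0n.
  by apply: eq_bigr.
- by move=> phi [|q s].
- by move=> phi; rewrite big_ord0.
(* The cut at 0 isolates the new cell, so deletion restores the state; a cut at [i + 1] becomes a
   cut at [i]. *)
- move=> phi [|q s] // _; rewrite /branchB big_ord_recl /= map_succnK.
  congr (_ + _); by apply: eq_bigr => i _; rewrite /= map_succnK.
- by move=> phi psi [|q s] //=; rewrite -big_split.
- by move=> phi psi eq_phi [|q s] //=; apply: eq_bigr => i _; apply: eq_phi.
- by case=> // q s; apply: pred_ends_map_succn.
- by case.
Qed.

(** * Words generated by inserting largest letters *)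

Definition insert (p M : nat) (t : seq nat) : seq nat := take p t ++ M :: drop p t.

Lemma size_insert p M t : size (insert p M t) = (size t).+1.
Proof. by rewrite size_cat /= addnS -size_cat cat_take_drop. Qed.

Lemma nth_insert p M t : p <= size t -> nth 0 (insert p M t) p = M.
Proof. by move=> le_p; rewrite nth_cat size_takel // ltnn subnn. Qed.

Lemma nth_insert_bump p M t q : p <= size t ->
  nth 0 (insert p M t) (bump p q) = nth 0 t q.
Proof.
move=> le_p; rewrite nth_cat size_takel // /bump.
have [le_pq|lt_qp] := leqP p q; last by rewrite add0n lt_qp nth_take.
by rewrite add1n ltnNge leqW //= subSn //= nth_drop subnKC.
Qed.

Lemma perm_insert p M t : perm_eq (insert p M t) (M :: t).
Proof. by rewrite perm_catC /= perm_cons perm_catC cat_take_drop. Qed.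

Lemma drop_insert e p M t : e <= size t ->
  drop e (insert (e + p) M t) = insert p M (drop e t).
Proof.
move=> le_e; rewrite /insert takeD -catA drop_cat size_takel // ltnn subnn.
by rewrite drop0 drop_drop addnC.
Qed.

Lemma take_insert e p M t : e <= size t -> take e (insert (e + p) M t) = take e t.
Proof.
by move=> le_e; rewrite /insert takeD -catA take_cat size_takel // ltnn subnn take0 cats0.
Qed.

Section Words.

Variable bad : nat -> nat -> nat -> bool.
Variable legal : nat -> seq nat -> nat -> bool.

Definition avoid (t : seq nat) : Prop := forall p1 p2 p3,
  p1 < p2 -> p2 < p3 -> p3 < size t -> ~~ bad (nth 0 t p1) (nth 0 t p2) (nth 0 t p3).

(** Positions below [e] are outside the shape in the row of [M], so legality is decided by the rest
    of the word. *)
Definition insertions (M e : nat) (u : seq nat) : seq (seq nat) :=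
  if e <= size u then
    [seq insert (e + p) M u | p <- iota 0 (size u - e).+1 & legal M (drop e u) p]
  else [::].

Fixpoint add_letters (M e k : nat) (l : seq (seq nat)) : seq (seq nat) :=
  if k is k'.+1 then flatten [seq insertions M e u | u <- add_letters M e k' l]
  else l.

Fixpoint words (e b : nat -> nat) (m : nat) : seq (seq nat) :=
  if m is m'.+1 then add_letters m' (e m') (b m') (words e b m') else [:: [::]].

Variables e b : nat -> nat.
Hypothesis e_homo : {homo e : i j / i <= j}.

(* Positions count columns from the right, so that [e r] is the number of columns
   missing in row [r] and a letter [r] is inside the shape iff it is at a position
   at least [e r]; this is stable under insertion of columns.  The largest letter
   of a forbidden triple is always one of its last two. *)
Record valid (m k : nat) (w : seq nat) : Prop := Valid {
  valid_le : all (fun x => x <= m) w;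
  valid_top : count_mem m w = k;
  valid_count : forall r, r < m -> count_mem r w = b r;
  valid_shape : forall p, p < size w -> e (nth 0 w p) <= p;
  valid_avoid : forall p1 p2 p3, p1 < p2 -> p2 < p3 -> p3 < size w ->
    bad (nth 0 w p1) (nth 0 w p2) (nth 0 w p3) ->
    p1 < e (maxn (nth 0 w p2) (nth 0 w p3)) }.

Lemma valid0 w : valid 0 0 w <-> w = [::].
Proof.
split=> [[le0 top0 _ _ _]|->]; last by split.
case: w le0 top0 => //= x w /andP[]; rewrite leqn0 => /eqP-> _.
by rewrite eqxx.
Qed.

Lemma validS m w : valid m.+1 0 w <-> valid m (b m) w.
Proof.
split=> [[leS topS cS shS avS]|[le top c sh av]]; split=> //.
- apply/allP=> x xw; have := allP leS x xw; rewrite leq_eqVlt => /orP[/eqP xm|//].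
  move/eqP: topS; rewrite -leqn0 leqNgt -has_count => /hasP[].
  by exists x => //=; apply/eqP.
- exact: cS.
- by move=> r lt_r; apply: cS; apply: ltnW.
- by apply: sub_all le => x /leqW.
- apply/eqP; rewrite -leqn0 leqNgt -has_count; apply/hasP=> -[x xw /= /eqP xm].
  by have := allP le x xw; rewrite xm ltnn.
- by move=> r; rewrite ltnS leq_eqVlt => /orP[/eqP->|/c].
Qed.

(** Letters are at most [m], so from position [e m] on no forbidden triple is excused by the
    shape. *)
Lemma valid_avoid_drop m k w : valid m k w -> avoid (drop (e m) w).
Proof.
case=> le _ _ _ av p1 p2 p3 lt12 lt23; rewrite size_drop => lt3.
rewrite !nth_drop; apply/negP => /av.
rewrite !ltn_add2l lt12 lt23 => /(_ isT isT).
have lt3w : e m + p3 < size w by lia.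
move=> /(_ lt3w); set M := maxn _ _; suff leM : e M <= e m.
  by rewrite ltnNge (leq_trans leM) ?leq_addr.
apply: e_homo; rewrite geq_max !(allP le) // mem_nth //.
by rewrite (ltn_trans _ lt3w) ?ltn_add2l.
Qed.

Hypothesis legal_avoid : forall M t p,
  all (fun x => x <= M) t -> p <= size t -> avoid t -> legal M t p ->
  avoid (insert p M t).
Hypothesis legal_ex : forall M t,
  all (fun x => x <= M) t -> M \in t -> avoid t ->
  exists p u, [/\ p <= size u, t = insert p M u & legal M u p].
Hypothesis legal_inj : forall M t t' p p', p <= size t -> p' <= size t' ->
  legal M t p -> legal M t' p' -> insert p M t = insert p' M t' ->
  p = p' /\ t = t'.

Lemma insertionsP M f u w :
  reflect (exists p, [/\ f + p <= size u, legal M (drop f u) p & w = insert (f + p) M u])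
    (w \in insertions M f u).
Proof.
rewrite /insertions; case: leqP => [le_f|lt_f]; last first.
  constructor=> -[p [le_fp _ _]]; move: lt_f.
  by rewrite ltnNge (leq_trans (leq_addr p f)).
apply: (iffP mapP) => -[p].
  rewrite mem_filter mem_iota => /andP[lg lt_p] ->; exists p; split=> //; lia.
move=> [le_p lg ->]; exists p => //; rewrite mem_filter lg mem_iota; lia.
Qed.

(** A copy of the largest letter is taken out of, or put into, the suffix from [e m] on; triples
    that contain it but start earlier are excused by the shape. *)
Lemma valid_insertions m k w : valid m k.+1 w <->
  exists2 u, valid m k u & w \in insertions m (e m) u.
Proof.
set f := e m; split=> [V|[u V /insertionsP[p [le_p lg ->]]]].
  have [le top c sh av] := V.
  have m_in : m \in drop f w.
    have : m \in w by rewrite -has_pred1 has_count top.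
    move=> /(nthP 0)[i lt_i wi]; have := sh i lt_i; rewrite wi -/f => le_fi.
    apply/(nthP 0); exists (i - f); last by rewrite nth_drop subnKC.
    by rewrite size_drop; lia.
  have lef : f <= size w.
    by rewrite leqNgt; apply/negP => /ltnW /drop_oversize dn; rewrite dn in m_in.
  have le_d : all (fun x => x <= m) (drop f w).
    by apply/allP=> x /mem_drop /(allP le).
  have [p [t [le_p def_t lg]]] := legal_ex le_d m_in (valid_avoid_drop V).
  pose u := take f w ++ t.
  have le_fu : f <= size u by rewrite size_cat size_takel // leq_addr.
  have du : drop f u = t by rewrite drop_cat size_takel // ltnn subnn drop0.
  have tu : take f u = take f w.
    by rewrite take_cat size_takel // ltnn subnn take0 cats0.
  have su : size u = f + size t by rewrite size_cat size_takel.
  have le_fp : f + p <= size u by rewrite su leq_add2l.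
  have def_w : w = insert (f + p) m u.
    rewrite -(cat_take_drop f (insert _ _ _)) take_insert // drop_insert //.
    by rewrite tu du -def_t cat_take_drop.
  exists u; last by apply/insertionsP; exists p; rewrite du.
  have pw := perm_insert (f + p) m u; rewrite -def_w in pw.
  have sw : size w = (size u).+1 by rewrite def_w size_insert.
  have nw q : nth 0 w (bump (f + p) q) = nth 0 u q.
    by rewrite def_w nth_insert_bump.
  have leu : all (fun x => x <= m) u.
    by move: le; rewrite (perm_all _ pw) => /andP[].
  have ltb q : q < size u -> bump (f + p) q < size w.
    by rewrite sw /bump; lia.
  split=> //.
  - by move: top; rewrite (permP pw) /= eqxx => -[].
  - move=> r lt_r; rewrite -c // (permP pw) /= (_ : (m == r) = false) //.
    by rewrite gtn_eqF.
  - move=> q lt_q; have := sh _ (ltb q lt_q); rewrite nw /bump.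
    (* A letter behind the removed one moves down by one, but stays at a position at least
       [f = e m], which bounds [e] on all letters present. *)
    have [le_fpq _|_] := leqP (f + p) q; last by [].
    apply: leq_trans (e_homo (allP leu _ (mem_nth 0 lt_q))) _.
    exact: leq_trans (leq_addr p f) le_fpq.
  - move=> p1 p2 p3 lt12 lt23 lt3; rewrite -!nw => /av.
    have -> : bump (f + p) p1 < bump (f + p) p2 by rewrite /bump; lia.
    have -> : bump (f + p) p2 < bump (f + p) p3 by rewrite /bump; lia.
    move=> /(_ isT isT (ltb _ lt3)); apply: leq_ltn_trans.
    by rewrite /bump leq_addl.
have [le top c sh av] := V.
have le_fu : f <= size u by apply: leq_trans le_p; apply: leq_addr.
set w' := insert _ _ _.
have pw : perm_eq w' (m :: u) by apply: perm_insert.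
have le' : all (fun x => x <= m) w' by rewrite (perm_all _ pw) /= leqnn.
have nw q : nth 0 w' (bump (f + p) q) = nth 0 u q by apply: nth_insert_bump.
have nM : nth 0 w' (f + p) = m by apply: nth_insert.
have sw : size w' = (size u).+1 by apply: size_insert.
split=> //.
- by rewrite (permP pw) /= eqxx top.
- move=> r lt_r; rewrite -c // (permP pw) /= (_ : (m == r) = false) //.
  by rewrite gtn_eqF.
- move=> q; case: (eqVneq q (f + p)) => [-> _|neq_q]; first by rewrite nM leq_addr.
  rewrite -(unbumpK neq_q) nw sw => lt_q.
  have lt_u : unbump (f + p) q < size u.
    by move: lt_q le_p; rewrite (unbumpK neq_q) /unbump; move: neq_q => /eqP; lia.
  by apply: leq_trans (sh _ lt_u) _; rewrite /bump leq_addl.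
move=> p1 p2 p3 lt12 lt23 lt3 bd.
case: (leqP f p1) => [le_f1|lt_1f].
  have le_d : all (fun x => x <= m) (drop f u).
    by apply/allP=> x /mem_drop /(allP le).
  have le_pd : p <= size (drop f u) by rewrite size_drop; lia.
  have := legal_avoid le_d le_pd (valid_avoid_drop V) lg.
  rewrite -/f -drop_insert // -/w' => /(_ (p1 - f) (p2 - f) (p3 - f)).
  rewrite size_drop !nth_drop !subnKC ?bd //; try lia.
(* A triple starting before [f] is excused if its maximum is [m]; otherwise the new letter is not
   among the three, and the triple comes from [u]. *)
have : maxn (nth 0 w' p2) (nth 0 w' p3) <= m.
  by rewrite geq_max !(allP le') ?mem_nth ?(ltn_trans lt23).
rewrite leq_eqVlt => /orP[/eqP->|ltM]; first exact: lt_1f.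
have n1 : p1 != f + p by apply/eqP; lia.
have n2 : p2 != f + p.
  by apply: contraTneq ltM => ->; rewrite nM gtn_max ltnn.
have n3 : p3 != f + p.
  by apply: contraTneq ltM => ->; rewrite nM gtn_max ltnn andbF.
move: bd; rewrite -(unbumpK n1) -(unbumpK n2) -(unbumpK n3) !nw.
move/av; rewrite !(unbumpK n1).
have -> : unbump (f + p) p1 = p1 by rewrite /unbump; lia.
apply; rewrite /unbump; move/eqP: n2 n3 => n2 /eqP; lia.
Qed.

Lemma uniq_flatten_map (l : seq (seq nat)) (F : seq nat -> seq (seq nat)) :
  uniq l -> (forall u, uniq (F u)) ->
  (forall u v w, w \in F u -> w \in F v -> u = v) -> uniq (flatten (map F l)).
Proof.
move=> + uF disj; elim: l => //= u l IHl /andP[u_l /IHl ul].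
rewrite cat_uniq uF ul andbT /=; apply/hasPn => w /flatten_mapP[v v_l wv].
by apply: contra u_l => /= /(disj _ _ _)/(_ wv)->.
Qed.

(** A new word determines its source: its first [f] letters are untouched, and [legal_inj] recovers
    the rest. *)
Lemma uniq_add_letters M f k l : uniq l -> uniq (add_letters M f k l).
Proof.
move=> ul; elim: k => //= k IHk; apply: uniq_flatten_map => // [u|u v w].
  rewrite /insertions; case: leqP => // le_f.
  rewrite map_inj_in_uniq ?filter_uniq ?iota_uniq // => p p'.
  rewrite !mem_filter !mem_iota => /andP[lg le] /andP[lg' le'].
  move/(congr1 (drop f)); rewrite !drop_insert // => eqi.
  by have [] := legal_inj _ _ lg lg' eqi; rewrite ?size_drop; lia.
move=> /insertionsP[p [le lg ->]] /insertionsP[p' [le' lg' eqi]].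
have lef : f <= size u by lia.
have lef' : f <= size v by lia.
rewrite -(cat_take_drop f u) -(cat_take_drop f v).
have := congr1 (take f) eqi; rewrite !take_insert // => ->.
have := congr1 (drop f) eqi; rewrite !drop_insert // => eqd.
by have [||_ ->] := legal_inj _ _ lg lg' eqd; rewrite ?size_drop //; lia.
Qed.

Lemma uniq_words m : uniq (words e b m).
Proof. by elim: m => //= m IHm; apply: uniq_add_letters. Qed.

Lemma mem_add_letters m k w :
  reflect (valid m k w) (w \in add_letters m (e m) k (words e b m)).
Proof.
apply: (iffP idP); last first.
  elim: m k w => [|m IHm] k w.
    elim: k w => [w /valid0-> //|k IHk w /valid_insertions[u /IHk Vu wu]].
    by apply/flatten_mapP; exists u.
  elim: k w => [w /validS/IHm //|k IHk w /valid_insertions[u /IHk Vu wu]].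
  by apply/flatten_mapP; exists u.
elim: m k w => [|m IHm] k w.
  elim: k w => [w|k IHk w]; first by rewrite inE => /eqP->; apply/valid0.
  by move=> /flatten_mapP[u /IHk Vu wu]; apply/valid_insertions; exists u.
elim: k w => [w /IHm Vw|k IHk w]; first exact/validS.
by move=> /flatten_mapP[u /IHk Vu wu]; apply/valid_insertions; exists u.
Qed.

Lemma mem_words m w : reflect (valid m 0 w) (w \in words e b m).
Proof. exact: (mem_add_letters m 0). Qed.

(** * Sums over partial words as sums over runs of a machine *)

Variable ends : seq nat -> seq nat.
Variable push : seq nat -> seq nat.
Variable branch : (seq nat -> nat) -> seq nat -> nat.

Hypothesis ends_eq0 : forall t, (ends t == [::]) = (t == [::]).
Hypothesis ends_behead : forall x t, avoid (x :: t) -> ends t = pred_ends (ends (x :: t)).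
Hypothesis sum_ends : forall M t phi, all (fun x => x <= M) t -> avoid t ->
  \sum_(p <- iota 0 (size t).+1 | legal M t p) phi (ends (insert p M t)) =
  step push branch (if M \in t then Same else Add) phi (ends t).

Definition word_sum m k (phi : seq nat -> nat) : nat :=
  \sum_(w <- add_letters m (e m) k (words e b m) | e m <= size w)
    phi (ends (drop (e m) w)).

(** Summing over the place of the last inserted [m] yields one [step]. The suffix from [e m] on
    contains every copy of [m], so the step is an [Add] exactly for the first copy. *)
Lemma word_sumS m k phi :
  word_sum m k.+1 phi =
  word_sum m k (step push branch (if k is 0 then Add else Same) phi).
Proof.
rewrite /word_sum /= big_flatten /= big_map big_mkcond [in RHS]big_seq_cond.
rewrite big_seq [in RHS]big_mkcondr /=; apply: eq_bigr => u /mem_add_letters V.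
rewrite /insertions; case: leqP => le_e; last by rewrite big_nil.
rewrite big_map big_filter_cond.
have le_d : all (fun x => x <= m) (drop (e m) u).
  by apply/allP=> x /mem_drop /(allP (valid_le V)).
have := sum_ends phi le_d (valid_avoid_drop V).
have -> : (m \in drop (e m) u) = (0 < k).
  rewrite -has_pred1 has_count -(valid_top V) -!has_count !has_pred1.
  apply/idP/idP => [/mem_drop //|/(nthP 0)[i lt_i ui]].
  have := valid_shape V lt_i; rewrite ui => le_i.
  apply/(nthP 0); exists (i - e m); last by rewrite nth_drop subnKC.
  by rewrite size_drop; lia.
case: k {V} => [|k] /= <-; rewrite size_drop.
all: apply: eq_big => [p|p _]; last by rewrite drop_insert.
all: by rewrite size_insert leqW ?andbT.
Qed.

Lemma sum_remove d t phi : avoid t ->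
  iter d remove phi (ends t) = if d <= size t then phi (ends (drop d t)) else 0.
Proof.
elim: d t phi => [|d IHd] t phi av; first by rewrite drop0.
rewrite iterS; case: t av => [|x t] av.
  by have /eqP-> : ends [::] == [::] by rewrite ends_eq0.
rewrite /remove; case ends_xt: (ends (x :: t)) => [|q s].
  by have := ends_eq0 (x :: t); rewrite ends_xt.
rewrite -ends_xt -ends_behead // IHd // => p1 p2 p3 lt12 lt23 lt3.
exact: (av p1.+1 p2.+1 p3.+1).
Qed.

(** Moving up one row hides [e m.+1 - e m] further leading letters, one [remove] for each. *)
Lemma word_sum0 m phi :
  word_sum m.+1 0 phi = word_sum m (b m) (iter (e m.+1 - e m) remove phi).
Proof.
rewrite /word_sum /= big_seq_cond big_mkcondr [RHS]big_seq_cond [RHS]big_mkcondr /=.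
apply: eq_bigr => w /mem_add_letters V.
have le_e : e m <= e m.+1 by apply: e_homo.
rewrite sum_remove; last exact: valid_avoid_drop V.
rewrite size_drop drop_drop subnK //.
have [le_w|lt_w] := leqP (e m) (size w); last first.
  by rewrite leqNgt (leq_trans lt_w le_e).
by rewrite leq_sub2rE.
Qed.

End Words.

Lemma insert_inj p M t t' : p <= size t -> p <= size t' ->
  insert p M t = insert p M t' -> t = t'.
Proof.
move=> le_p le_p' /eqP; rewrite eqseq_cat ?size_takel // eqseq_cons eqxx /=.
by case/andP=> /eqP eqt /eqP eqd; rewrite -(cat_take_drop p t) eqt eqd cat_take_drop.
Qed.

Lemma mem_nth_drop (t : seq nat) p j : p <= j -> j < size t -> nth 0 t j \in drop p t.
Proof.
move=> le_j lt_j; rewrite -(subnKC le_j) -nth_drop mem_nth // size_drop.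
by rewrite ltn_sub2r // (leq_ltn_trans le_j).
Qed.

Lemma pred_ends_filter (c : pred nat) n :
  pred_ends (filter c (iota 0 n.+1)) = filter (c \o succn) (iota 0 n).
Proof.
rewrite -[n.+1]addn1 addnC iotaD /= (iotaDl 1) filter_map /=.
case: (c 0); first by rewrite /= map_succnK.
exact: pred_ends_map_succn.
Qed.

(** Serves both pairs of patterns, with [c] and [c'] testing for ends before and after an insertion
    at [p]. *)
Lemma filter_iota_insert (c c' : pred nat) n p : p <= n ->
  (forall q, q < p -> ~~ c' q) -> c' p ->
  (forall q, p <= q < n -> c' q.+1 = c q) ->
  filter c' (iota 0 n.+1) =
  p :: map succn (filter (leq p) (filter c (iota 0 n))).
Proof.
move=> le_p c'lt c'p; rewrite -(subnKC le_p); move: (n - p) => d c'gt.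
rewrite -addnS !iotaD /=.
rewrite !filter_cat !add0n (_ : filter c' (iota 0 p) = [::]); last first.
  apply/eqP; rewrite -size_eq0 size_filter -leqn0 leqNgt -has_count.
  by apply/hasPn => q; rewrite mem_iota => /c'lt.
rewrite (_ : filter _ (filter c (iota 0 p)) = [::]); last first.
  apply/eqP; rewrite -size_eq0 size_filter -leqn0 leqNgt -has_count.
  by apply/hasPn => q; rewrite mem_filter mem_iota -ltnNge => /andP[_].
rewrite /= c'p; congr cons; rewrite -add1n (iotaDl 1) filter_map; congr map.
rewrite -filter_predI; apply: eq_in_filter => q.
rewrite mem_iota => /andP[le_pq lt_q] /=.
by rewrite add1n c'gt ?le_pq.
Qed.

Lemma sorted_filter_iota (c : pred nat) n : sorted ltn (filter c (iota 0 n)).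
Proof. by apply: sorted_filter (iota_ltn_sorted 0 n); apply: ltn_trans. Qed.

(** * The patterns 231 and 121 *)

(* The patterns are read backwards, i.e. as 132 and 121. *)
Definition badA (x1 x2 x3 : nat) : bool := (x1 <= x3) && (x3 < x2).

Definition cut (t : seq nat) (p : nat) : bool :=
  allrel (fun x y => y < x) (take p t) (drop p t).

(** The newest copy of [M] is the last one, which makes its position recoverable. *)
Definition legalA (M : nat) (t : seq nat) (p : nat) : bool :=
  (M \notin drop p t) && cut t p.

Definition endsA (t : seq nat) : seq nat :=
  [seq q <- iota 0 (size t) | cut t q.+1].

Lemma cutP t p :
  reflect (forall i j, i < p -> p <= j -> j < size t -> nth 0 t j < nth 0 t i)
    (cut t p).
Proof.
apply: (iffP allrelP) => [ct i j lt_i le_j lt_j|ct x y].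
  apply: ct.
    by rewrite -(nth_take 0 lt_i) mem_nth // size_takel // ltnW // (leq_ltn_trans le_j).
  exact: mem_nth_drop.
move=> /(nthP 0)[i lt_i <-] /(nthP 0)[j lt_j <-].
move: lt_i lt_j; rewrite size_take_min leq_min size_drop => /andP[lt_i _] lt_j.
by rewrite nth_take // nth_drop; apply: ct; rewrite ?leq_addr // -ltn_subRL.
Qed.

(** As a largest letter, the new one could only be the middle of a forbidden triple, but across a
    cut the third entry is smaller than the first. *)
Lemma legalA_avoid M t p : all (fun x => x <= M) t -> p <= size t ->
  avoid badA t -> legalA M t p -> avoid badA (insert p M t).
Proof.
move=> le le_p av /andP[_ /cutP ct] p1 p2 p3 lt12 lt23 lt3.
have leM q : nth 0 (insert p M t) q <= M.
  have lei : all (fun x => x <= M) (insert p M t).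
    by rewrite (perm_all _ (perm_insert p M t)) /= leqnn.
  have [lt_q|ge_q] := ltnP q (size (insert p M t)).
    exact: (allP lei) (mem_nth 0 lt_q).
  by rewrite nth_default.
apply/negP => bd; move: (bd) => /andP[le13 lt32].
have [e1|n1] := eqVneq p1 p.
  by move: (leM p2) le13 lt32; rewrite e1 nth_insert //; lia.
have [e3|n3] := eqVneq p3 p.
  by move: (leM p2) le13 lt32; rewrite e3 nth_insert //; lia.
rewrite size_insert in lt3; move/eqP: (n1) => n1'; move/eqP: (n3) => n3'.
have lt3' : unbump p p3 < size t by rewrite /unbump; lia.
have [e2|n2] := eqVneq p2 p.
  have := ct (unbump p p1) (unbump p p3) _ _ lt3'.
  rewrite -!(nth_insert_bump M _ le_p) (unbumpK n1) (unbumpK n3) => H.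
  by move: le13; rewrite leqNgt H // /unbump; lia.
move/eqP: (n2) => n2'.
have := av (unbump p p1) (unbump p p2) (unbump p p3) _ _ lt3'.
rewrite -!(nth_insert_bump M _ le_p) (unbumpK n1) (unbumpK n2) (unbumpK n3) bd.
by move=> H; suff: false by []; apply: H; rewrite /unbump; lia.
Qed.

Lemma split_last (M : nat) (t : seq nat) : M \in t ->
  exists t1 t2, t = t1 ++ M :: t2 /\ M \notin t2.
Proof.
elim: t => //= x t IHt; have [/IHt[t1 [t2 [-> Mt2]]] _|Mt] := boolP (M \in t).
  by exists (x :: t1), t2.
by rewrite in_cons (negPf Mt) orbF => /eqP <-; exists [::], t.
Qed.

Lemma insert_cat M t1 t2 : insert (size t1) M (t1 ++ t2) = t1 ++ M :: t2.
Proof. by rewrite /insert take_size_cat // drop_size_cat. Qed.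

(** The last [M] stands at a cut: a letter before it and one at least as large after it would
    complete a forbidden triple. *)
Lemma legalA_ex M t : all (fun x => x <= M) t -> M \in t -> avoid badA t ->
  exists p u, [/\ p <= size u, t = insert p M u & legalA M u p].
Proof.
move=> le /split_last[t1 [t2 [def_t Mt2]]] av.
exists (size t1), (t1 ++ t2); split; first by rewrite size_cat leq_addr.
  by rewrite insert_cat.
rewrite /legalA /cut take_size_cat // drop_size_cat // Mt2.
apply/allrelP => x y /(nthP 0)[i lt_i xi] y2; rewrite ltnNge; apply/negP => le_xy.
have /(nthP 0)[j lt_j yj] := y2.
have nx : nth 0 t i = x by rewrite def_t nth_cat lt_i.
have nM : nth 0 t (size t1) = M by rewrite def_t nth_cat ltnn subnn.
have ny : nth 0 t (size t1 + j.+1) = y.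
  by rewrite def_t nth_cat ltnNge leq_addr addKn.
have lt_t : size t1 + j.+1 < size t by rewrite def_t size_cat ltn_add2l.
have := av i (size t1) (size t1 + j.+1) lt_i _ lt_t.
rewrite nx nM ny /badA le_xy /= => H.
have lt_yM : y < M.
  rewrite ltn_neqAle (allP le) ?andbT; last first.
    by rewrite def_t mem_cat in_cons y2 !orbT.
  by apply: contraNneq Mt2 => <-.
by move: H; rewrite lt_yM addnS ltnS leq_addr => /(_ isT).
Qed.

Lemma legalA_inj M t t' p p' : p <= size t -> p' <= size t' ->
  legalA M t p -> legalA M t' p' -> insert p M t = insert p' M t' ->
  p = p' /\ t = t'.
Proof.
wlog le_pp' : t t' p p' / p <= p' => [wl|].
  have [|lt_pp'] := leqP p p'; first exact: wl.
  move=> le le' lg lg' eqi.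
  by have [->->] := wl t' t p' p (ltnW lt_pp') le' le lg' lg (esym eqi).
move=> le le' /andP[Md _] /andP[_ _] eqi.
have szt : size t = size t' by move/(congr1 size): eqi; rewrite !size_insert => -[].
have eqp : p = p'.
  apply/eqP; rewrite eqn_leq le_pp' leqNgt; apply: contra Md => lt_pp'.
  have := nth_insert M le'; rewrite -eqi -(prednK (leq_ltn_trans (leq0n p) lt_pp')).
  have -> : p'.-1.+1 = bump p p'.-1 by rewrite /bump; lia.
  rewrite nth_insert_bump // => <-.
  by apply: mem_nth_drop; lia.
by subst p'; split=> //; apply: insert_inj le le' eqi.
Qed.

Lemma endsA_eq0 t : (endsA t == [::]) = (t == [::]).
Proof.
case: t => // x t; apply: negbTE; rewrite -has_filter; apply/hasP.
exists (size t); first by rewrite mem_iota /= ltnS leqnn.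
by apply/cutP => i j _ /=; lia.
Qed.

(** A cut of [t] stays a cut behind [x]: otherwise [x], the first letter of [t] and some letter
    beyond the cut form a forbidden triple. *)
Lemma endsA_behead x t : avoid badA (x :: t) -> endsA t = pred_ends (endsA (x :: t)).
Proof.
move=> av; rewrite /endsA pred_ends_filter; apply: eq_in_filter => q.
rewrite mem_iota /= => lt_q; apply/cutP/cutP => ct i j lt_i le_j lt_j.
  case: j le_j lt_j => // j le_j lt_j; case: i lt_i => [|i] lt_i; last exact: ct.
  have lt0 := ct 0 j isT le_j lt_j.
  have := av 0 1 j.+1 isT _ lt_j; rewrite /badA /= lt0 andbT -ltnNge; apply.
  by clear -le_j; lia.
exact: (ct i.+1 j.+1).
Qed.

Lemma endsA_insert M t p : all (fun x => x <= M) t -> p <= size t ->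
  legalA M t p -> endsA (insert p M t) = p :: map succn (filter (leq p) (endsA t)).
Proof.
move=> le le_p /andP[Md /cutP ct]; rewrite /endsA size_insert.
have leM q : nth 0 t q <= M.
  have [lt_q|ge_q] := ltnP q (size t); last by rewrite nth_default.
  exact: (allP le) (mem_nth 0 lt_q).
have ltM q : p <= q -> q < size t -> nth 0 t q < M.
  move=> le_pq lt_q; rewrite ltn_neqAle leM andbT; apply: contraNneq Md => <-.
  exact: mem_nth_drop.
apply: filter_iota_insert => // [q lt_q||q /andP[le_pq lt_q]].
(* No cut separates the first letter from [M], which is at least as large. *)
- apply/cutP => /(_ 0 p isT lt_q); rewrite size_insert ltnS => /(_ le_p).
  have := nth_insert_bump M 0 le_p; rewrite /bump leqNgt (leq_ltn_trans _ lt_q) // add0n.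
  by move=> ->; rewrite nth_insert // ltnNge leM.
- apply/cutP => i j lt_i le_j; rewrite size_insert => lt_j.
  have nj : j != p by rewrite gtn_eqF.
  rewrite -(unbumpK nj) nth_insert_bump //.
  have le_uj : p <= unbump p j by rewrite /unbump; lia.
  have lt_uj : unbump p j < size t by rewrite /unbump; lia.
  have [->|ni] := eqVneq i p; first by rewrite nth_insert //; apply: ltM.
  rewrite -(unbumpK ni) nth_insert_bump //; apply: ct => //.
  by move/eqP: ni; rewrite /unbump; lia.
- apply/cutP/cutP => ct' i j lt_i le_j.
    move=> lt_j; have := ct' (bump p i) (bump p j).
    by rewrite !nth_insert_bump // size_insert; apply; rewrite /bump; lia.
  rewrite size_insert => lt_j.
  have nj : j != p by apply/eqP; lia.
  rewrite -(unbumpK nj) nth_insert_bump //.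
  have le_uj : q < unbump p j by rewrite /unbump; lia.
  have lt_uj : unbump p j < size t by rewrite /unbump; lia.
  have [->|ni] := eqVneq i p; first by rewrite nth_insert //; apply: ltM; lia.
  rewrite -(unbumpK ni) nth_insert_bump //; apply: ct' => //.
  by move/eqP: ni; rewrite /unbump; lia.
Qed.

Lemma sum_suffix (s : seq nat) phi : sorted ltn s ->
  \sum_(q <- s) phi (q :: filter (ltn q) s) = suffix_sum phi s.
Proof.
elim: s => [|q s IHs] /=; first by rewrite big_nil.
rewrite (path_sortedE ltn_trans) => /andP[q_s /IHs <-].
rewrite big_cons ltnn (all_filterP q_s); congr (_ + _).
apply: eq_big_seq => r /(allP q_s) /= lt_qr.
by rewrite ltnNge ltnW.
Qed.

Lemma sum_endsA M t phi : all (fun x => x <= M) t -> avoid badA t ->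
  \sum_(p <- iota 0 (size t).+1 | legalA M t p) phi (endsA (insert p M t)) =
  step pushA branchA (if M \in t then Same else Add) phi (endsA t).
Proof.
move=> le _; transitivity (\sum_(p <- iota 0 (size t).+1 | legalA M t p)
    phi (p :: map succn (filter (leq p) (endsA t)))).
  rewrite big_seq_cond [RHS]big_seq_cond; apply: eq_bigr => p.
  rewrite mem_iota ltnS => /andP[/andP[_ le_p] lg].
  by rewrite endsA_insert.
(* Position 0 is the [push], legal only if [M] is absent. The other legal positions are the [q + 1]
   for ends [q]; beyond such a cut all letters are below the first one, so [M] does not occur
   there. *)
rewrite -[(size t).+1]addn1 addnC iotaD /= big_cons (iotaDl 1) big_map.
set S := \sum_(q <- _ | _) _; have -> : S = branchA phi (endsA t).
  rewrite /branchA -sum_suffix ?sorted_filter_iota // big_filter /S.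
  rewrite big_seq_cond [RHS]big_seq_cond; apply: eq_big => // q.
  rewrite mem_iota /= add1n; case: ltnP => //= lt_q.
  rewrite /legalA; case: (boolP (cut _ _)) => [/cutP ct|]; last by rewrite andbF.
  rewrite andbT; apply/negP => /(nthP 0)[j]; rewrite size_drop nth_drop => lt_j Mj.
  have : M < nth 0 t 0 by rewrite -Mj ct ?leq_addr // -ltn_subRL.
  by rewrite ltnNge (allP le) // mem_nth // (leq_ltn_trans _ lt_q).
rewrite /legalA drop0 /cut take0 allrel0l andbT.
by case: (M \in t) => //=; rewrite (all_filterP _) //; apply/allP.
Qed.

(** * The patterns 312 and 211 *)

(* The patterns are read backwards, i.e. as 213 and 112. *)
Definition badB (x1 x2 x3 : nat) : bool := (x2 <= x1) && (x1 < x3).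

(** Here the newest copy of [M] is the first one. *)
Definition legalB (M : nat) (t : seq nat) (p : nat) : bool :=
  (M \notin take p t) && sorted ltn (take p t).

Definition run_end (t : seq nat) (q : nat) : bool :=
  (size t <= q.+1) || (nth 0 t q.+1 <= nth 0 t q).

Definition endsB (t : seq nat) : seq nat := filter (run_end t) (iota 0 (size t)).

Lemma sorted_takeP t p : p <= size t ->
  reflect (forall i j, i < j -> j < p -> nth 0 t i < nth 0 t j)
    (sorted ltn (take p t)).
Proof.
move=> le_p; apply: (iffP idP) => [st i j lt_ij lt_jp|lt_t].
  have lt_ip := ltn_trans lt_ij lt_jp.
  have := sorted_ltn_nth ltn_trans 0 st i j.
  by rewrite !inE size_takel // !nth_take //; apply.
apply/(sortedP 0) => i; rewrite size_takel // => lt_i.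
by rewrite !nth_take ?(ltnW lt_i) //; apply: lt_t.
Qed.

(** As a largest letter, the new one could only end a forbidden triple, whose first two entries
    cannot both lie in an increasing prefix. *)
Lemma legalB_avoid M t p : all (fun x => x <= M) t -> p <= size t ->
  avoid badB t -> legalB M t p -> avoid badB (insert p M t).
Proof.
move=> le le_p av /andP[_ /(sorted_takeP le_p) st] p1 p2 p3 lt12 lt23 lt3.
have leM q : nth 0 (insert p M t) q <= M.
  have lei : all (fun x => x <= M) (insert p M t).
    by rewrite (perm_all _ (perm_insert p M t)) /= leqnn.
  have [lt_q|ge_q] := ltnP q (size (insert p M t)).
    exact: (allP lei) (mem_nth 0 lt_q).
  by rewrite nth_default.
apply/negP => bd; move: (bd) => /andP[le21 lt13].
have [e1|n1] := eqVneq p1 p.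
  by move: (leM p3) le21 lt13; rewrite e1 nth_insert //; lia.
have [e2|n2] := eqVneq p2 p.
  by move: (leM p3) le21 lt13; rewrite e2 nth_insert //; lia.
rewrite size_insert in lt3; move/eqP: (n1) => n1'; move/eqP: (n2) => n2'.
have [e3|n3] := eqVneq p3 p.
  have := st (unbump p p1) (unbump p p2).
  rewrite -!(nth_insert_bump M _ le_p) (unbumpK n1) (unbumpK n2) => H.
  by move: le21; rewrite leqNgt H // /unbump; lia.
move/eqP: (n3) => n3'.
have lt3' : unbump p p3 < size t by rewrite /unbump; lia.
have := av (unbump p p1) (unbump p p2) (unbump p p3) _ _ lt3'.
rewrite -!(nth_insert_bump M _ le_p) (unbumpK n1) (unbumpK n2) (unbumpK n3) bd.
by move=> H; suff: false by []; apply: H; rewrite /unbump; lia.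
Qed.

(** Two adjacent letters before the first [M] that fail to increase would form a forbidden triple
    with it. *)
Lemma sorted_take_index M t : all (fun x => x <= M) t -> M \in t -> avoid badB t ->
  sorted ltn (take (index M t) t).
Proof.
move=> le Mt av; have lt_i : index M t < size t by rewrite index_mem.
apply/(sortedP 0) => i; rewrite size_takel ?(ltnW lt_i) // => lt_j.
rewrite !nth_take ?(ltnW lt_j) //.
have := av i i.+1 (index M t) (ltnSn i) lt_j lt_i.
rewrite nth_index // /badB.
have : nth 0 t i < M.
  rewrite ltn_neqAle (allP le) ?andbT; last by rewrite mem_nth // (ltn_trans (ltnW lt_j)).
  by have := before_find 0 (ltnW lt_j) => /= ->.
by move=> ->; rewrite andbT -ltnNge.
Qed.

Lemma legalB_ex M t : all (fun x => x <= M) t -> M \in t -> avoid badB t ->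
  exists p u, [/\ p <= size u, t = insert p M u & legalB M u p].
Proof.
move=> le Mt av; have lt_i : index M t < size t by rewrite index_mem.
have st : size (take (index M t) t) = index M t by rewrite size_takel 1?ltnW.
exists (index M t), (take (index M t) t ++ drop (index M t).+1 t); split.
- by rewrite size_cat st leq_addr.
- rewrite -[X in insert X]st insert_cat -[X in X :: drop _ _](nth_index 0 Mt).
  by rewrite -drop_nth // cat_take_drop.
- rewrite /legalB take_size_cat // sorted_take_index // andbT.
  by rewrite in_take ?ltnn // ltnW.
Qed.

Lemma legalB_inj M t t' p p' : p <= size t -> p' <= size t' ->
  legalB M t p -> legalB M t' p' -> insert p M t = insert p' M t' ->
  p = p' /\ t = t'.
Proof.
move=> le le' /andP[Mt _] /andP[Mt' _] eqi.
have indexE q u : q <= size u -> M \notin take q u -> index M (insert q M u) = q.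
  move=> le_q Mu; rewrite index_cat (negPf Mu) /= eqxx addn0 size_takel //.
have eqp : p = p' by rewrite -(indexE p t) // eqi indexE.
by subst p'; split=> //; apply: insert_inj le le' eqi.
Qed.

Lemma endsB_eq0 t : (endsB t == [::]) = (t == [::]).
Proof.
case: t => // x t; apply: negbTE; rewrite -has_filter; apply/hasP.
by exists (size t); rewrite ?mem_iota /run_end /= ?ltnS leqnn.
Qed.

Lemma endsB_behead x t : avoid badB (x :: t) -> endsB t = pred_ends (endsB (x :: t)).
Proof. by move=> _; rewrite /endsB pred_ends_filter. Qed.

Lemma endsB_insert M t p : all (fun x => x <= M) t -> p <= size t ->
  legalB M t p -> endsB (insert p M t) = p :: map succn (filter (leq p) (endsB t)).
Proof.
move=> le le_p /andP[Mt /(sorted_takeP le_p) st]; rewrite /endsB size_insert.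
have leM q : nth 0 t q <= M.
  have [lt_q|ge_q] := ltnP q (size t); last by rewrite nth_default.
  exact: (allP le) (mem_nth 0 lt_q).
have nlt q : q < p -> nth 0 (insert p M t) q = nth 0 t q.
  by move=> lt_q; rewrite -(nth_insert_bump M q le_p) /bump leqNgt lt_q.
have ngt q : p <= q -> nth 0 (insert p M t) q.+1 = nth 0 t q.
  by move=> le_q; rewrite -(nth_insert_bump M q le_p) /bump le_q.
apply: filter_iota_insert => // [q lt_q||q /andP[le_pq lt_q]].
- rewrite /run_end negb_or -!ltnNge size_insert ltnS (leq_trans lt_q) //= nlt //.
  move: (lt_q); rewrite leq_eqVlt => /orP[/eqP e|lt_q1]; last by rewrite nlt ?st.
  rewrite e nth_insert // ltn_neqAle leM andbT; apply: contraNneq Mt => <-.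
  by rewrite -(nth_take 0 lt_q) mem_nth // size_takel.
- by rewrite /run_end nth_insert // ngt // leM orbT.
- by rewrite /run_end size_insert ltnS !ngt // leqW.
Qed.

(** The first end [q] closes the initial increasing run, which has [q + 1] letters. *)
Lemma sorted_take_ends t q s p : endsB t = q :: s -> p <= size t ->
  sorted ltn (take p t) = (p <= q.+1).
Proof.
move=> et le_p; have : q \in endsB t by rewrite et mem_head.
rewrite mem_filter mem_iota => /andP[eq_q] /= lt_q.
have min_q i : i \in endsB t -> q <= i.
  have := sorted_filter_iota (run_end t) (size t); rewrite -/(endsB t) et /=.
  rewrite (path_sortedE ltn_trans) in_cons => /andP[/allP q_s _].
  by case/predU1P => [->//|/q_s/ltnW].
apply/(sortedP 0)/idP => [st|le_pq i].
  rewrite leqNgt; apply/negP => lt_qp; have := st q; rewrite size_takel // => /(_ lt_qp).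
  rewrite !nth_take ?(ltnW lt_qp) // /= ltnNge.
  by case/orP: eq_q => [|->//]; rewrite leqNgt (leq_trans lt_qp).
rewrite size_takel // => lt_i; rewrite !nth_take ?(ltnW lt_i) // /= ltnNge.
have lt_iq : i < q by apply: leq_trans lt_i le_pq.
apply: contraL lt_iq => le_n; rewrite -leqNgt; apply: min_q.
by rewrite mem_filter mem_iota /run_end le_n orbT /= (leq_trans (ltnW lt_i)).
Qed.

Lemma sum_endsB M t phi : all (fun x => x <= M) t -> avoid badB t ->
  \sum_(p <- iota 0 (size t).+1 | legalB M t p) phi (endsB (insert p M t)) =
  step pushB branchB (if M \in t then Same else Add) phi (endsB t).
Proof.
move=> le av; transitivity (\sum_(p <- iota 0 (size t).+1 | legalB M t p)
    phi (p :: map succn (filter (leq p) (endsB t)))).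
  rewrite big_seq_cond [RHS]big_seq_cond; apply: eq_bigr => p.
  rewrite mem_iota ltnS => /andP[/andP[_ le_p] lg].
  by rewrite endsB_insert.
case et: (endsB t) => [|q s].
  have /eqP -> : t == [::] by rewrite -endsB_eq0 et.
  by rewrite /= big_cons big_nil.
have : q \in endsB t by rewrite et mem_head.
rewrite mem_filter mem_iota => /andP[eq_q] /= lt_q.
have q_s : all (ltn q) s.
  have := sorted_filter_iota (run_end t) (size t); rewrite -/(endsB t) et /=.
  by rewrite (path_sortedE ltn_trans) => /andP[].
(* The bound [K] will be [q] if [M] occurs in [t], and [q + 1] otherwise. *)
have sumE K : K <= size t -> (forall p, p <= size t -> legalB M t p = (p <= K)) ->
    \sum_(p <- iota 0 (size t).+1 | legalB M t p)
      phi (p :: map succn (filter (leq p) (q :: s))) =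
    \sum_(p < K.+1) phi ((p : nat) :: map succn (filter (leq p) (q :: s))).
  move=> le_K lgE; rewrite -(big_mkord xpredT
    (fun p => phi (p :: map succn (filter (leq p) (q :: s))))).
  rewrite (big_nat_widen _ _ (size t).+1) // /index_iota subn0.
  rewrite big_seq_cond [RHS]big_seq_cond; apply: eq_bigl => p.
  by rewrite mem_iota ltnS /=; case: leqP => //= le_p; rewrite lgE ?ltnS.
have branchE : \sum_(p < q.+1) phi ((p : nat) :: map succn (filter (leq p) (q :: s)))
    = branchB phi (q :: s).
  apply: eq_bigr => p _; congr (phi (_ :: map _ _)); apply/all_filterP.
  rewrite /= -ltnS ltn_ord; apply: sub_all q_s => r /= lt_qr.
  by apply: leq_trans (ltnW lt_qr); rewrite -ltnS.
case: (boolP (M \in t)) => Mt.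
  (* The first [M] closes the first run: the letters up to it increase, and the next one is not
     larger. *)
  have iq : index M t = q.
    have lt_i : index M t < size t by rewrite index_mem.
    apply/eqP; rewrite eqn_leq; apply/andP; split.
      rewrite leqNgt; apply/negP => lt_qi.
      have := sorted_take_index le Mt av; rewrite (sorted_take_ends et) ?(ltnW lt_i) //.
      move=> le_iq; have iq : index M t = q.+1 by apply/eqP; rewrite eqn_leq le_iq.
      case/orP: eq_q; rewrite -iq; first by rewrite leqNgt lt_i.
      rewrite nth_index // => le_M; have /eqP[] := before_find 0 lt_qi.
      by apply/eqP/negPn; rewrite negbK /= eqn_leq le_M (allP le) ?mem_nth.
    have : index M t \in endsB t.
      rewrite mem_filter mem_iota /= lt_i andbT /run_end nth_index //.
      case: leqP => //= lt_i1; exact: (allP le) (mem_nth 0 lt_i1).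
    by rewrite et in_cons => /predU1P[->//|/(allP q_s)/ltnW].
  rewrite (sumE q) ?branchE ?(ltnW lt_q) // => p le_p.
  rewrite /legalB (sorted_take_ends et) // in_take // iq -leqNgt.
  by case: leqP => // /leqW.
rewrite (sumE q.+1) // => [|p le_p]; last first.
  rewrite /legalB (sorted_take_ends et) //.
  by rewrite (contra (@mem_take _ _ _ _) Mt).
(* The extra position [q + 1], right after the first run, is the [push]. *)
rewrite big_ord_recr branchE /= addnC ltnn; congr (phi (_ :: map _ _) + _).
exact/all_filterP.
Qed.

(** * From fillings to words *)

Definition missing (lam : seq nat) (r : nat) : nat := head 0 lam - nth 0 lam r.

Definition filling_of (lam x : seq nat) : rect lam :=
  [ffun ij : 'I_(size lam) * 'I_(head 0 lam) => nth 0 x ij.2 == ij.1].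

(** Every insertion and deletion prepends the same operation to [D] on both sides, until only the
    empty word is left. *)
Lemma word_sum_AB (e b : nat -> nat) m k D : {homo e : i j / i <= j} -> e 0 = 0 ->
  word_sum legalA e b endsA m k (runs pushA branchA D) =
  word_sum legalB e b endsB m k (runs pushB branchB D).
Proof.
move=> e_homo e0.
have SA := word_sumS b e_homo legalA_avoid legalA_ex sum_endsA.
have SB := word_sumS b e_homo legalB_avoid legalB_ex sum_endsB.
have ZA := word_sum0 b e_homo legalA_avoid legalA_ex endsA_eq0 endsA_behead.
have ZB := word_sum0 b e_homo legalB_avoid legalB_ex endsB_eq0 endsB_behead.
have iter_remove d push branch D' :
    iter d remove (runs push branch D') = runs push branch (nseq d Remove ++ D').
  by elim: d => //= d ->.
elim: m k D => [|m IHm]; elim=> [|k IHk] D.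
- by rewrite /word_sum /= !big_cons !big_nil e0 /= runs_AB.
- rewrite SA SB; exact: (IHk (_ :: D)).
- by rewrite ZA ZB !iter_remove IHm.
- rewrite SA SB; exact: (IHk (_ :: D)).
Qed.

Section Fillings.

Variable lam : seq nat.
Hypothesis lamF : ferrers lam.

Local Notation n := (head 0 lam).
Local Notation m := (size lam).

Lemma nth_lam_anti i j : i <= j -> nth 0 lam j <= nth 0 lam i.
Proof.
case/andP: lamF => lam_sorted _ le_ij.
have [lt_j|ge_j] := ltnP j m; last by rewrite (nth_default _ ge_j).
have geq_trans : transitive geq by move=> x y z /= le1 le2; apply: leq_trans le1.
have := sorted_leq_nth geq_trans leqnn 0 lam_sorted.
by apply; rewrite ?inE // (leq_ltn_trans le_ij).
Qed.

Lemma missing_homo : {homo missing lam : i j / i <= j}.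
Proof. by move=> i j /nth_lam_anti le_ij; apply: leq_sub2l. Qed.

Lemma missing0 : missing lam 0 = 0.
Proof. by rewrite /missing nth0 subnn. Qed.

(** Row [m] lies above the shape and misses all [n] columns, so a word exhausted by the deletions
    has length exactly [n]. *)
Lemma size_words (legal : nat -> seq nat -> nat -> bool) (b : nat -> nat) ends :
  (forall t, (ends t == [::]) = (t == [::])) ->
  size [seq w <- words legal (missing lam) b m | size w == n] =
  word_sum legal (missing lam) b ends m 0 (fun s => s == [::] : nat).
Proof.
move=> ends_eq0; have em : missing lam m = n by rewrite /missing nth_default // subn0.
rewrite /word_sum /= em.
rewrite size_filter -sum1_count big_mkcond [RHS]big_mkcond /=.
apply: eq_bigr => w _; rewrite ends_eq0 -size_eq0 size_drop.
by rewrite subn_eq0 eqn_leq andbC; case: leqP => //= _; case: leqP.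
Qed.

Lemma size_words_AB (b : nat -> nat) :
  size [seq w <- words legalA (missing lam) b m | size w == n] =
  size [seq w <- words legalB (missing lam) b m | size w == n].
Proof.
rewrite (size_words _ _ endsA_eq0) (size_words _ _ endsB_eq0).
exact: (word_sum_AB b m 0 [::] missing_homo missing0).
Qed.

(** * Pattern containment in the filling given by a word *)

Section Word.

Variable x : seq nat.
Hypothesis size_x : size x = n.
Hypothesis ltx : all (fun r => r < m) x.

Local Notation F := (filling_of lam x).

Lemma nth_x_lt c : c < n -> nth 0 x c < m.
Proof. by rewrite -size_x => /(mem_nth 0)/(allP ltx). Qed.

Lemma one_per_column_filling_of : one_per_column F.
Proof.
apply/forallP => c; apply/cards1P; exists (Ordinal (nth_x_lt (ltn_ord c))).
by apply/setP => r; rewrite !inE ffunE /= eq_sym.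
Qed.

Lemma is_filling_of : is_filling F = [forall c : 'I_n, c < nth 0 lam (nth 0 x c)].
Proof.
apply/forallP/forallP => [H c|H [r c]].
  have := H (Ordinal (nth_x_lt (ltn_ord c)), c).
  by rewrite ffunE /= eqxx /in_shape /= => /andP[].
by rewrite ffunE /=; apply/implyP => /eqP <-; rewrite /in_shape nth_x_lt ?H.
Qed.

Lemma row_count_filling_of r : row_count F r = count_mem r x.
Proof.
rewrite /row_count -sum1_count (big_nth 0) size_x big_mkord -sum1_card.
apply: eq_bigl => c; rewrite inE /entry valK.
case: insubP => [i _ <-|]; first by rewrite ffunE.
by rewrite -leqNgt => le_r; apply/esym/ltn_eqF/(leq_trans _ le_r)/nth_x_lt.
Qed.

(** As the rows increase strictly, matching the pattern matrix amounts to one equation per column.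
    Each letter up to the largest occurs in [y], so each chosen row holds a 1 and is a row of
    [lam]. *)
Lemma containsP y : all (leq 1) y -> (forall l, l < maxletter y -> l.+1 \in y) ->
  contains F y <-> exists rows cols : nat -> nat,
    [/\ forall i j, i < j -> j < maxletter y -> rows i < rows j,
        forall i j, i < j -> j < size y -> cols i < cols j,
        forall j, j < size y -> cols j < n,
        forall j, j < size y -> nth 0 x (cols j) = rows (nth 0 y j).-1 &
        forall l j, l < maxletter y -> j < size y -> cols j < nth 0 lam (rows l)].
Proof.
move=> y_gt0 y_full.
have le_max j : j < size y -> 0 < nth 0 y j <= maxletter y.
  move=> lt_j; rewrite (allP y_gt0) ?mem_nth //=.
  elim: (y) j lt_j => //= z s IHs [|j] lt_j; first exact: leq_maxl.
  by apply: leq_trans (IHs j lt_j) _; apply: leq_maxr.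
split.
  case/existsP=> rho /existsP[col /andP[/andP[/forallP r_inc /forallP c_inc] /forallP H]].
  exists (fun l => oapp (fun i => val (rho i)) 0 (insub l)).
  exists (fun l => oapp (fun i => val (col i)) 0 (insub l)).
  split=> [i j lt_ij lt_j|i j lt_ij lt_j|j lt_j|j lt_j|l j lt_l lt_j].
  - rewrite !insubT ?(ltn_trans lt_ij) // => lt_i /=.
    exact: (implyP (forallP (r_inc (Ordinal lt_i)) (Ordinal lt_j))).
  - rewrite !insubT ?(ltn_trans lt_ij) // => lt_i /=.
    exact: (implyP (forallP (c_inc (Ordinal lt_i)) (Ordinal lt_j))).
  - by rewrite insubT /=.
  - have /andP[y0 ymax] := le_max j lt_j.
    have lt_l : (nth 0 y j).-1 < maxletter y by rewrite prednK.
    have /andP[_] := forallP (H (Ordinal lt_l)) (Ordinal lt_j).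
    rewrite ffunE /= prednK // eqxx eqb_id => /eqP.
    by rewrite !insubT /=.
  - have /andP[/andP[_]] := forallP (H (Ordinal lt_l)) (Ordinal lt_j).
    by rewrite !insubT /=.
case=> rows [cols [r_inc c_inc c_lt xE sh]].
have r_lt l : l < maxletter y -> rows l < m.
  move=> /y_full /(nthP 0)[j lt_j yj].
  by have := xE j lt_j; rewrite yj /= => <-; apply/nth_x_lt/c_lt.
apply/existsP; exists [ffun l : 'I_(maxletter y) => Ordinal (r_lt l (ltn_ord l))].
apply/existsP; exists [ffun j : 'I_(size y) => Ordinal (c_lt j (ltn_ord j))].
apply/andP; split; first apply/andP; first split.
- apply/forallP => l1; apply/forallP => l2; apply/implyP => lt12.
  by rewrite !ffunE /= r_inc.
- apply/forallP => l1; apply/forallP => l2; apply/implyP => lt12.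
  by rewrite !ffunE /= c_inc.
apply/forallP => l; apply/forallP => j; rewrite !ffunE /= /in_shape r_lt // sh //=.
have /andP[y0 ymax] := le_max j (ltn_ord j).
rewrite xE //; apply/eqP; rewrite -[in RHS](prednK y0) eqSS.
have lt_l : (nth 0 y j).-1 < maxletter y by rewrite prednK.
case: (ltngtP (nth 0 y j).-1 l) => [lt|lt|->]; last by rewrite eqxx.
  by apply: ltn_eqF; apply: r_inc.
by apply: gtn_eqF; apply: r_inc.
Qed.

(** The triple is read from right to left. For [badA] and [badB] the maximum is the top row, and its
    cell in the rightmost column forces all the others into the shape. *)
Definition occurs (bad : nat -> nat -> nat -> bool) : Prop := exists c1 c2 c3,
  [/\ c1 < c2, c2 < c3, c3 < n, bad (nth 0 x c3) (nth 0 x c2) (nth 0 x c1) &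
      c3 < nth 0 lam (maxn (nth 0 x c2) (nth 0 x c1))].

Lemma containsA :
  contains F [:: 2; 3; 1] || contains F [:: 1; 2; 1] <-> occurs badA.
Proof.
have full3 l : l < 3 -> l.+1 \in [:: 2; 3; 1] by case: l => [|[|[|]]].
have full2 l : l < 2 -> l.+1 \in [:: 1; 2; 1] by case: l => [|[|]].
split.
  case/orP=> /containsP[] // rows [cols [r_inc c_inc c_lt xE sh]].
    exists (cols 0), (cols 1), (cols 2).
    rewrite !c_inc // c_lt // !xE //= /badA; split=> //.
      by rewrite r_inc // ltnW // r_inc.
    by rewrite (maxn_idPl _) ?sh // ltnW // r_inc.
  exists (cols 0), (cols 1), (cols 2).
  rewrite !c_inc // c_lt // !xE //= /badA; split=> //.
    by rewrite r_inc // leqnn.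
  by rewrite (maxn_idPl _) ?sh // ltnW // r_inc.
case=> c1 [c2 [c3 [lt12 lt23 lt3 /andP[le31 lt_12]]]].
have lt13 := ltn_trans lt12 lt23.
rewrite (maxn_idPl (ltnW lt_12)) => sh.
have sh' c r : c <= c3 -> r <= nth 0 x c2 -> c < nth 0 lam r.
  by move=> le_c /nth_lam_anti le_r; apply: leq_ltn_trans le_c (leq_trans sh le_r).
(* Equality of the outer letters gives 121, strict inequality 231. *)
apply/orP; move: (le31); rewrite leq_eqVlt => /orP[/eqP e31|lt31].
  right; apply/containsP => //.
  exists (nth 0 [:: nth 0 x c1; nth 0 x c2]), (nth 0 [:: c1; c2; c3]); split.
  - by case=> [|[|i]] [|[|j]].
  - by case=> [|[|[|i]]] [|[|[|j]]].
  - by case=> [|[|[|j]]] //= _; lia.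
  - by case=> [|[|[|j]]] //=.
  - by case=> [|[|l]] [|[|[|j]]] //= _ _; apply: sh'; lia.
left; apply/containsP => //.
exists (nth 0 [:: nth 0 x c3; nth 0 x c1; nth 0 x c2]), (nth 0 [:: c1; c2; c3]); split.
- by case=> [|[|[|i]]] [|[|[|j]]] //= _ _; apply: ltn_trans lt_12.
- by case=> [|[|[|i]]] [|[|[|j]]].
- by case=> [|[|[|j]]] //= _; lia.
- by case=> [|[|[|j]]] //=.
- by case=> [|[|[|l]]] [|[|[|j]]] //= _ _; apply: sh'; lia.
Qed.

Lemma containsB :
  contains F [:: 3; 1; 2] || contains F [:: 2; 1; 1] <-> occurs badB.
Proof.
have full3 l : l < 3 -> l.+1 \in [:: 3; 1; 2] by case: l => [|[|[|]]].
have full2 l : l < 2 -> l.+1 \in [:: 2; 1; 1] by case: l => [|[|]].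
split.
  case/orP=> /containsP[] // rows [cols [r_inc c_inc c_lt xE sh]].
    exists (cols 0), (cols 1), (cols 2).
    rewrite !c_inc // c_lt // !xE //= /badB; split=> //.
      by rewrite r_inc // ltnW // r_inc.
    by rewrite (maxn_idPr _) ?sh // ltnW // r_inc.
  exists (cols 0), (cols 1), (cols 2).
  rewrite !c_inc // c_lt // !xE //= /badB; split=> //.
    by rewrite r_inc // leqnn.
  by rewrite (maxn_idPr _) ?sh // ltnW // r_inc.
case=> c1 [c2 [c3 [lt12 lt23 lt3 /andP[le23 lt_31]]]].
have lt13 := ltn_trans lt12 lt23.
have lt_21 := leq_ltn_trans le23 lt_31.
rewrite (maxn_idPr (ltnW lt_21)) => sh.
have sh' c r : c <= c3 -> r <= nth 0 x c1 -> c < nth 0 lam r.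
  by move=> le_c /nth_lam_anti le_r; apply: leq_ltn_trans le_c (leq_trans sh le_r).
(* Equality of the last two letters gives 211, strict inequality 312. *)
apply/orP; move: (le23); rewrite leq_eqVlt => /orP[/eqP e23|lt_23].
  right; apply/containsP => //.
  exists (nth 0 [:: nth 0 x c2; nth 0 x c1]), (nth 0 [:: c1; c2; c3]); split.
  - by case=> [|[|i]] [|[|j]].
  - by case=> [|[|[|i]]] [|[|[|j]]].
  - by case=> [|[|[|j]]] //= _; lia.
  - by case=> [|[|[|j]]] //=.
  - by case=> [|[|l]] [|[|[|j]]] //= _ _; apply: sh'; lia.
left; apply/containsP => //.
exists (nth 0 [:: nth 0 x c2; nth 0 x c3; nth 0 x c1]), (nth 0 [:: c1; c2; c3]); split.
- by case=> [|[|[|i]]] [|[|[|j]]].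
- by case=> [|[|[|i]]] [|[|[|j]]].
- by case=> [|[|[|j]]] //= _; lia.
- by case=> [|[|[|j]]] //=.
- by case=> [|[|[|l]]] [|[|[|j]]] //= _ _; apply: sh'; lia.
Qed.

End Word.

End Fillings.

(** * Counting fillings by words *)

Section Cardinal.

Variable lam : seq nat.
Hypothesis lamF : ferrers lam.

Local Notation n := (head 0 lam).
Local Notation m := (size lam).

(** Column [c] becomes position [n - c.+1], and [missing lam r <= n - c.+1] says that row [r]
    reaches column [c]. *)
Lemma valid_rev bad (b : nat -> nat) x : size x = n -> all (fun r => r < m) x ->
  valid bad (missing lam) b m 0 (rev x) <->
  [/\ forall c : 'I_n, c < nth 0 lam (nth 0 x c),
      forall r, r < m -> count_mem r x = b r & ~ occurs lam x bad].
Proof.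
move=> size_x ltx.
have le_n r : nth 0 lam r <= n by rewrite -nth0; apply: nth_lam_anti.
have nth_rev_x p : p < n -> nth 0 (rev x) p = nth 0 x (n - p.+1).
  by move=> lt_p; rewrite nth_rev size_x.
split=> [[_ _ cnt sh av]|[sh cnt av]].
  split=> [c|r lt_r|[c1 [c2 [c3 [lt12 lt23 lt3 bd lt_top]]]]].
  - have lt_c : n - c.+1 < n by rewrite ltn_subrL /= (leq_ltn_trans _ (ltn_ord c)).
    have := sh (n - c.+1); rewrite size_rev size_x => /(_ lt_c).
    rewrite nth_rev_x // (_ : n - (n - c.+1).+1 = c); last by have := ltn_ord c; lia.
    by have := le_n (nth 0 x c); have := ltn_ord c; rewrite /missing; lia.
  - by rewrite -cnt // count_rev.
  - have nth_rev_xK c : c < n -> nth 0 (rev x) (n - c.+1) = nth 0 x c.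
      by move=> lt_c; rewrite nth_rev_x; [congr nth|]; lia.
    have lt2 := ltn_trans lt23 lt3; have lt1 := ltn_trans lt12 lt2.
    have := av (n - c3.+1) (n - c2.+1) (n - c1.+1).
    rewrite size_rev size_x !nth_rev_xK // => H.
    have : n - c3.+1 < missing lam (maxn (nth 0 x c2) (nth 0 x c1)).
      by apply: H => //; lia.
    have := le_n (maxn (nth 0 x c2) (nth 0 x c1)).
    by rewrite /missing; lia.
split.
- by rewrite all_rev; apply: sub_all ltx => r /ltnW.
- rewrite count_rev; apply/eqP; rewrite -leqn0 leqNgt -has_count.
  by apply/hasPn => r /(allP ltx) /= lt_r; rewrite ltn_eqF.
- by move=> r lt_r; rewrite count_rev cnt.
- move=> p; rewrite size_rev size_x => lt_p; rewrite nth_rev_x //.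
  have lt_c : n - p.+1 < n by rewrite ltn_subrL /= (leq_ltn_trans _ lt_p).
  by have := sh (Ordinal lt_c); rewrite /missing /=; lia.
- move=> p1 p2 p3 lt12 lt23; rewrite size_rev size_x => lt3.
  rewrite !nth_rev_x; try lia.
  move=> bd; rewrite ltnNge; apply/negP => le_top; apply: av.
  exists (n - p3.+1), (n - p2.+1), (n - p1.+1); split=> //; try lia.
  have := le_n (maxn (nth 0 x (n - p2.+1)) (nth 0 x (n - p3.+1))).
  by move: le_top; rewrite /missing; lia.
Qed.

Lemma row_sums_filling_of a x : size x = n -> all (fun r => r < m) x ->
  row_sums a (filling_of lam x) <->
  (forall r, r < m -> count_mem r x = nth 0 a r) /\ all (pred1 0) (drop m a).
Proof.
move=> size_x ltx.
have cnt0 r : m <= r -> count_mem r x = 0.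
  move=> le_r; apply/eqP; rewrite -leqn0 leqNgt -has_count.
  by apply/hasPn => q /(allP ltx) /= lt_q; rewrite ltn_eqF // (leq_trans lt_q).
split=> [/forallP H|[cnt a0]].
  have cnt r : r < maxn m (size a) -> count_mem r x = nth 0 a r.
    move=> lt_r; rewrite -(row_count_filling_of size_x ltx).
    exact/eqP/(H (Ordinal lt_r)).
  split=> [r lt_r|]; first by apply: cnt; rewrite leq_max lt_r.
  apply/(all_nthP 0) => i; rewrite size_drop nth_drop => lt_i /=.
  by rewrite -cnt ?cnt0 ?leq_addr // leq_max -[X in _ || X]ltn_subRL lt_i orbT.
apply/forallP => -[r lt_r]; rewrite row_count_filling_of //=.
have [lt_rm|le_mr] := ltnP r m; first by rewrite cnt.
rewrite cnt0 // eq_sym -(subnKC le_mr) -nth_drop.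
have [lt_d|ge_d] := ltnP (r - m) (size (drop m a)); last by rewrite nth_default.
exact: (all_nthP 0 a0).
Qed.

Lemma filling_of_inj x x' : size x = n -> size x' = n ->
  all (fun r => r < m) x -> filling_of lam x = filling_of lam x' -> x = x'.
Proof.
move=> size_x size_x' ltx eqF; apply: (@eq_from_nth _ 0); first by rewrite size_x.
rewrite size_x => c lt_c; have lt_xc := nth_x_lt size_x ltx lt_c.
move/ffunP/(_ (Ordinal lt_xc, Ordinal lt_c)): eqF.
by rewrite !ffunE /= eqxx => /esym/eqP.
Qed.

Lemma one_per_column_ex (F : rect lam) : one_per_column F ->
  exists x, [/\ size x = n, all (fun r => r < m) x & F = filling_of lam x].
Proof.
move=> /forallP H.
have /fin_all_exists[f fE] c : exists r0, [set r | F (r, c)] = [set r0].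
  exact/cards1P.
exists [seq val (f c) | c <- enum 'I_n]; split.
- by rewrite size_map size_enum_ord.
- by apply/allP => _ /mapP[c _ ->] /=.
apply/ffunP => -[r c]; rewrite ffunE /=.
rewrite (nth_map c) ?size_enum_ord // nth_ord_enum.
by move/setP/(_ r): (fE c); rewrite !inE eq_sym => ->.
Qed.

(** Reversal followed by [filling_of] maps the words of length [n] in [L] bijectively onto the set,
    which is empty if [a] demands ones above the top row. *)
Lemma card_W a Omega bad (L : seq (seq nat)) :
  (forall x, size x = n -> all (fun r => r < m) x ->
    all (avoids (filling_of lam x)) Omega <-> ~ occurs lam x bad) ->
  (forall w, reflect (valid bad (missing lam) (nth 0 a) m 0 w) (w \in L)) -> uniq L ->
  #|W lam a Omega| =
  if all (pred1 0) (drop m a) then size [seq w <- L | size w == n] else 0.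
Proof.
move=> OmegaE LP uniqL; case: ifP => a0; last first.
  apply: eq_card0 => F; rewrite !inE; apply/negP => /and4P[_ /one_per_column_ex].
  by case=> x [size_x ltx ->] /row_sums_filling_of[] // _; rewrite a0.
have memL w : w \in [seq w <- L | size w == n] ->
    [/\ valid bad (missing lam) (nth 0 a) m 0 w, size (rev w) = n
      & all (fun r => r < m) (rev w)].
  rewrite mem_filter => /andP[/eqP size_w /LP V]; split; rewrite ?size_rev //.
  rewrite all_rev; apply/allP => r rw; have := allP (valid_le V) r rw.
  rewrite leq_eqVlt => /orP[/eqP rm|//].
  by have := valid_top V; rewrite -rm => /count_memPn; rewrite rw.
have eqW : W lam a Omega =i
    [seq filling_of lam (rev w) | w <- L & size w == n].
  move=> F; rewrite inE; apply/and4P/mapP => [[fF oF rF avF]|[w wL ->]].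
    have [x [size_x ltx defF]] := one_per_column_ex oF.
    exists (rev x); last by rewrite revK.
    rewrite mem_filter size_rev size_x eqxx /=; apply/LP/valid_rev => //.
    move: fF rF avF; rewrite defF is_filling_of // => /forallP sh.
    by move=> /(row_sums_filling_of _ size_x ltx)[cnt _] /(OmegaE x size_x ltx).
  have [V size_x ltx] := memL w wL.
  have := proj1 (valid_rev bad (nth 0 a) size_x ltx).
  rewrite revK => /(_ V)[sh cnt av].
  split.
  - by rewrite is_filling_of //; apply/forallP.
  - exact: one_per_column_filling_of.
  - exact/row_sums_filling_of.
  - exact/OmegaE.
rewrite (eq_card eqW) (card_uniqP _) ?size_map // map_inj_in_uniq ?filter_uniq //.
move=> w w' /memL[_ size_w ltw] /memL[_ size_w' _] /filling_of_inj eqw.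
by apply: (can_inj revK); apply: eqw.
Qed.

End Cardinal.

Theorem theorem15 (lam a : seq nat) :
  ferrers lam -> all (fun x => 0 < x) a ->
  #|W lam a [:: [:: 2; 3; 1]; [:: 1; 2; 1]]| =
  #|W lam a [:: [:: 3; 1; 2]; [:: 2; 1; 1]]|.
Proof.
move=> lamF _; have e_homo := missing_homo lamF.
have avoidsE F y y' Q : (@contains lam F y || contains F y' <-> Q) ->
    all (avoids F) [:: y; y'] <-> ~ Q.
  rewrite /avoids /= andbT -negb_or => <-; split; first by move/negP.
  by move/negP.
have wordsA := mem_words (nth 0 a) e_homo legalA_avoid legalA_ex (size lam).
have wordsB := mem_words (nth 0 a) e_homo legalB_avoid legalB_ex (size lam).
have uniqA := uniq_words (missing lam) (nth 0 a) legalA_inj (size lam).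
have uniqB := uniq_words (missing lam) (nth 0 a) legalB_inj (size lam).
rewrite (card_W lamF _ wordsA uniqA) => [|x size_x ltx]; last first.
  exact/avoidsE/containsA.
rewrite (card_W lamF _ wordsB uniqB) => [|x size_x ltx]; last first.
  exact/avoidsE/containsB.
by rewrite size_words_AB.
Qed.
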